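(* There is a (deterministic) parallel algorithm with $O(\log m)$ depth and $O(m)$ work that, given an allocation instance with $m$ goods and two agents with additive valuations, outputs an $\mathsf{EF1}$ allocation.
   Context: An allocation instance consists of a set $M$ of $m$ indivisible goods, a set $N$ of $n$ agents, and for each agent $i$ an additive valuation $v_i:2^M\to\mathbb{R}_{\ge 0}$, i.e. $v_i(S)=\sum_{g\in S}v_i(g)$. An allocation partitions $M$ into bundles $\mathcal{A}(i)$, one per agent. It is envy-free up to one good ($\mathsf{EF1}$) if for every pair of agents $i,j$ there is a good $s\in\mathcal{A}(j)$ with $v_i(\mathcal{A}(i))\ge v_i(\mathcal{A}(j)\setminus\{s\})$ (with the convention that the condition holds trivially when $\mathcal{A}(j)$ is empty). Complexity is measured in the binary fork-join work-depth model: work is the total number of operations, depth is the length of the longest chain of sequential dependencies. *)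

(* Defs.v *)
From mathcomp Require Import all_boot all_order all_algebra.
From mathcomp Require Import reals.

Set Implicit Arguments.
Unset Strict Implicit.
Unset Printing Implicit Defensive.

Import Order.TTheory GRing.Theory Num.Theory.

Section Allocation.
Variables (R : realType) (n m : nat).
Local Open Scope ring_scope.

Definition additive_valuation (u : {set 'I_m} -> R) : Prop :=
  (forall S, 0 <= u S) /\ (forall S, u S = \sum_(g in S) u [set g]).

(* An allocation is given by the owner of each good, so that the bundles
   partition the goods (bundles may be empty). *)
Definition allocation := {ffun 'I_m -> 'I_n}.

Definition bundle (A : allocation) (i : 'I_n) : {set 'I_m} :=
  [set g | A g == i].

Definition EF1 (v : 'I_n -> {set 'I_m} -> R) (A : allocation) : Prop :=
  forall i j, bundle A j = set0 \/
    exists2 s, s \in bundle A j & v i (bundle A j :\ s) <= v i (bundle A i).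

End Allocation.

(* The binary fork-join model: a RAM whose threads have private registers and
   share one memory.  Registers and memory cells come in two sorts, machine
   words (indices, addresses, output) and reals (values of goods); reals can
   only be copied, added, subtracted and compared, and no real constant occurs
   in a program, so a program does not depend on the field of reals. *)

Inductive word_op := WAdd | WSub | WMul | WDiv.

Inductive real_op := RAdd | RSub.

(* The natural-number arguments are register numbers, except for the literal
   [x] of [WConst d x] and the procedure number of [Call]; [d] is a
   destination, and [a] in a load or store is the word register that holds the
   address. *)
Inductive cmd :=
| Skip
| WConst (d x : nat)
| WOp (o : word_op) (d a b : nat)
| WLoad (d a : nat)
| WStore (a s : nat)
| ROp (o : real_op) (d a b : nat)
| RLoad (d a : nat)
| RStore (a s : nat)
| Seq (c1 c2 : cmd)
| IfW (a b : nat) (c1 c2 : cmd)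
| IfR (a b : nat) (c1 c2 : cmd)
| Call (p : nat)
| Par (c1 c2 : cmd).

(* The bodies of finitely many, possibly mutually recursive, procedures;
   procedure 0 is the entry point. *)
Definition program := seq cmd.

Definition upd T (f : nat -> T) (x : nat) (y : T) : nat -> T :=
  fun z => if z == x then y else f z.

(* A shared cell: [inl a] is word cell [a], [inr a] is real cell [a]. *)
Definition loc := (nat + nat)%type.

Record trace := Trace {
  work : nat;
  depth : nat;
  reads : seq loc;
  writes : seq loc }.

Definition op_trace (rd wr : seq loc) : trace := Trace 1 1 rd wr.

Definition seq_trace (t1 t2 : trace) : trace :=
  Trace (work t1 + work t2) (depth t1 + depth t2)
        (reads t1 ++ reads t2) (writes t1 ++ writes t2).

Definition par_trace (t1 t2 : trace) : trace :=
  Trace (work t1 + work t2) (maxn (depth t1) (depth t2))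
        (reads t1 ++ reads t2) (writes t1 ++ writes t2).

Definition race_free (t1 t2 : trace) : bool :=
  ~~ has (mem (writes t1)) (reads t2 ++ writes t2) &&
  ~~ has (mem (writes t2)) (reads t1).

Definition word_eval (o : word_op) (x y : nat) : nat :=
  match o with
  | WAdd => x + y
  | WSub => x - y
  | WMul => x * y
  | WDiv => x %/ y
  end.

Section Semantics.
Variable R : realType.

Definition real_eval (o : real_op) (x y : R) : R :=
  match o with
  | RAdd => (x + y)%R
  | RSub => (x - y)%R
  end.

Record regs := Regs { wreg : nat -> nat; rreg : nat -> R }.

Record memory := Memory { wmem : nat -> nat; rmem : nat -> R }.

Definition merge (t1 : trace) (mu1 mu2 : memory) : memory :=
  Memory (fun a => if inl a \in writes t1 then wmem mu1 a else wmem mu2 a)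
         (fun a => if inr a \in writes t1 then rmem mu1 a else rmem mu2 a).

Variables (P : program) (W : nat).

(* [run c r mu r' mu' t]: command [c], started with registers [r] and shared
   memory [mu], terminates with registers [r'] and memory [mu'], performing the
   operations recorded in [t].
   - Words are the naturals below [W]; an overflowing operation has no run.
   - A callee, or a forked child, starts from a copy of the registers, and the
     registers of its parent are restored when it ends, so results are returned
     through memory.  A program mentions finitely many registers, whence the
     unit cost of a call or a fork.
   - The two children of a fork run on the memory at the fork.  A fork with a
     determinacy race (a cell written by one child and read or written by the
     other) has no run; without races all interleavings of the children end in
     the memory [merge t1 mu1 mu2]. *)
Inductive run : cmd -> regs -> memory -> regs -> memory -> trace -> Prop :=
| run_Skip r mu :
    run Skip r mu r mu (op_trace [::] [::])
| run_WConst d x r mu of x < W :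
    run (WConst d x) r mu
        (Regs (upd (wreg r) d x) (rreg r)) mu (op_trace [::] [::])
| run_WOp o d a b r mu of word_eval o (wreg r a) (wreg r b) < W :
    run (WOp o d a b) r mu
        (Regs (upd (wreg r) d (word_eval o (wreg r a) (wreg r b))) (rreg r)) mu
        (op_trace [::] [::])
| run_WLoad d a r mu :
    run (WLoad d a) r mu
        (Regs (upd (wreg r) d (wmem mu (wreg r a))) (rreg r)) mu
        (op_trace [:: inl (wreg r a)] [::])
| run_WStore a s r mu :
    run (WStore a s) r mu
        r (Memory (upd (wmem mu) (wreg r a) (wreg r s)) (rmem mu))
        (op_trace [::] [:: inl (wreg r a)])
| run_ROp o d a b r mu :
    run (ROp o d a b) r mu
        (Regs (wreg r) (upd (rreg r) d (real_eval o (rreg r a) (rreg r b)))) mu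
        (op_trace [::] [::])
| run_RLoad d a r mu :
    run (RLoad d a) r mu
        (Regs (wreg r) (upd (rreg r) d (rmem mu (wreg r a)))) mu
        (op_trace [:: inr (wreg r a)] [::])
| run_RStore a s r mu :
    run (RStore a s) r mu
        r (Memory (wmem mu) (upd (rmem mu) (wreg r a) (rreg r s)))
        (op_trace [::] [:: inr (wreg r a)])
| run_Seq c1 c2 r mu r1 mu1 t1 r2 mu2 t2
    of run c1 r mu r1 mu1 t1 & run c2 r1 mu1 r2 mu2 t2 :
    run (Seq c1 c2) r mu r2 mu2 (seq_trace t1 t2)
| run_IfW a b c1 c2 r mu r' mu' t
    of run (if wreg r a <= wreg r b then c1 else c2) r mu r' mu' t :
    run (IfW a b c1 c2) r mu r' mu' (seq_trace (op_trace [::] [::]) t)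
| run_IfR a b c1 c2 r mu r' mu' t
    of run (if (rreg r a <= rreg r b)%R then c1 else c2) r mu r' mu' t :
    run (IfR a b c1 c2) r mu r' mu' (seq_trace (op_trace [::] [::]) t)
| run_Call p r mu r' mu' t
    of run (nth Skip P p) r mu r' mu' t :
    run (Call p) r mu r mu' (seq_trace (op_trace [::] [::]) t)
| run_Par c1 c2 r mu r1 mu1 t1 r2 mu2 t2
    of run c1 r mu r1 mu1 t1 & run c2 r mu r2 mu2 t2 & race_free t1 t2 :
    run (Par c1 c2) r mu
        r (merge t1 mu1 mu2)
        (seq_trace (op_trace [::] [::]) (par_trace t1 t2)).

Lemma run_deterministic c r mu r1 mu1 t1 r2 mu2 t2 :
  run c r mu r1 mu1 t1 -> run c r mu r2 mu2 t2 ->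
  [/\ r1 = r2, mu1 = mu2 & t1 = t2].
Proof.
move=> H; elim: H r2 mu2 t2 => {c r mu r1 mu1 t1}.
all: try by intros; match goal with H : run _ _ _ _ _ _ |- _ =>
  inversion H; subst end.
- move=> c1 c2 r mu r1 mu1 t1 r2 mu2 t2 _ IH1 _ IH2 r' mu' t' H.
  inversion H; subst.
  match goal with H : run c1 _ _ _ _ _ |- _ => case: (IH1 _ _ _ H) end.
  move=> ? ? ?; subst.
  by match goal with H : run c2 _ _ _ _ _ |- _ => case: (IH2 _ _ _ H) end
    => -> -> ->.
- move=> a b c1 c2 r mu r' mu' t _ IH r2 mu2 t2 H; inversion H; subst.
  by match goal with H : run (if _ then _ else _) _ _ _ _ _ |- _ =>
    case: (IH _ _ _ H) end => -> -> ->.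
- move=> a b c1 c2 r mu r' mu' t _ IH r2 mu2 t2 H; inversion H; subst.
  by match goal with H : run (if _ then _ else _) _ _ _ _ _ |- _ =>
    case: (IH _ _ _ H) end => -> -> ->.
- move=> p r mu r' mu' t _ IH r2 mu2 t2 H; inversion H; subst.
  by match goal with H : run (nth _ _ _) _ _ _ _ _ |- _ =>
    case: (IH _ _ _ H) end => _ -> ->.
move=> c1 c2 r mu r1 mu1 t1 r2 mu2 t2 _ IH1 _ IH2 _ r' mu' t' H.
inversion H; subst.
match goal with H : run c1 _ _ _ _ _ |- _ => case: (IH1 _ _ _ H) end.
match goal with H : run c2 _ _ _ _ _ |- _ => case: (IH2 _ _ _ H) end.
by move=> _ -> -> _ -> ->.
Qed.

End Semantics.

(* Words of O(log m) bits. *)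
Definition word_bound (k m : nat) : nat := (m + 2) ^ k.

Definition input_regs (R : realType) (m : nat) : regs R :=
  Regs (upd (fun=> 0) 0 m) (fun=> 0%R).

(* The values of the goods are stored agent by agent at the start of the real
   memory; all other cells are 0. *)
Definition input_memory (R : realType) (n m : nat)
    (v : 'I_n -> {set 'I_m} -> R) (mu : memory R) : Prop :=
  [/\ forall a, wmem mu a = 0,
      forall (i : 'I_n) (g : 'I_m), rmem mu (i * m + g) = v i [set g]
    & forall a, n * m <= a -> rmem mu a = 0%R].

(* The index of the owner of good [g] is in word cell [g]. *)
Definition output_memory (R : realType) (n m : nat)
    (A : allocation n m) (mu : memory R) : Prop :=
  forall g : 'I_m, wmem mu g = A g.

(* Main.v *)
Require Import Defs.
From mathcomp Require Import all_boot all_order all_algebra.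
From mathcomp Require Import reals.
From mathcomp Require Import zify ring.

Set Implicit Arguments.
Unset Strict Implicit.
Unset Printing Implicit Defensive.

Import Order.TTheory GRing.Theory Num.Theory.

(** Let [l] be a good such that agent 0 weakly prefers [l, m) to [0, l) and
    [0, l] to (l, m).  Agent 1 takes the half [0, l) or (l, m) she prefers, and
    agent 0 gets the other half together with [l]: agent 0 does not envy, and
    agent 1 does not envy once [l] is removed.  To find [l], a parallel up-sweep
    stores the sums of the left halves met when [0, m) is halved recursively;
    one root-to-leaf descent then maintains the prefix sums of both agents, which
    also decide the choice of agent 1.  Her goods are marked by a parallel
    divide-and-conquer loop. *)

(** * Weakest preconditions for the fork-join machine *)

Section WeakestPrecondition.
Variables (R : realType) (P : program) (W : nat).
Implicit Types (r : regs R) (mu : memory R) (t : trace).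
Implicit Types (Q : regs R -> memory R -> trace -> Prop).

(** Total correctness: a run has to exist, which also excludes overflows and races. Postconditions
    see the trace, so cost is proved together with the result. *)
Definition wp c r mu Q : Prop :=
  exists r' mu' t, run P W c r mu r' mu' t /\ Q r' mu' t.

Lemma wp_mono c r mu Q1 Q2 :
  wp c r mu Q1 -> (forall r' mu' t, Q1 r' mu' t -> Q2 r' mu' t) ->
  wp c r mu Q2.
Proof.
by move=> [r' [mu' [t [H HQ]]]] Q12; exists r', mu', t; split=> //; apply: Q12.
Qed.

Lemma wp_Skip r mu Q : Q r mu (op_trace [::] [::]) -> wp Skip r mu Q.
Proof. by move=> HQ; do 3 eexists; split; [constructor | exact: HQ]. Qed.

Lemma wp_WConst d x r mu Q :
  x < W -> Q (Regs (upd (wreg r) d x) (rreg r)) mu (op_trace [::] [::]) ->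
  wp (WConst d x) r mu Q.
Proof. by move=> ? HQ; do 3 eexists; split; [constructor | exact: HQ]. Qed.

Lemma wp_WOp o d a b r mu Q :
  word_eval o (wreg r a) (wreg r b) < W ->
  Q (Regs (upd (wreg r) d (word_eval o (wreg r a) (wreg r b))) (rreg r)) mu
    (op_trace [::] [::]) ->
  wp (WOp o d a b) r mu Q.
Proof. by move=> ? HQ; do 3 eexists; split; [constructor | exact: HQ]. Qed.

Lemma wp_WStore a s r mu Q :
  Q r (Memory (upd (wmem mu) (wreg r a) (wreg r s)) (rmem mu))
    (op_trace [::] [:: inl (wreg r a)]) ->
  wp (WStore a s) r mu Q.
Proof. by move=> HQ; do 3 eexists; split; [constructor | exact: HQ]. Qed.

Lemma wp_ROp o d a b r mu Q :
  Q (Regs (wreg r) (upd (rreg r) d (real_eval o (rreg r a) (rreg r b)))) mu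
    (op_trace [::] [::]) ->
  wp (ROp o d a b) r mu Q.
Proof. by move=> HQ; do 3 eexists; split; [constructor | exact: HQ]. Qed.

Lemma wp_RLoad d a r mu Q :
  Q (Regs (wreg r) (upd (rreg r) d (rmem mu (wreg r a)))) mu
    (op_trace [:: inr (wreg r a)] [::]) ->
  wp (RLoad d a) r mu Q.
Proof. by move=> HQ; do 3 eexists; split; [constructor | exact: HQ]. Qed.

Lemma wp_RStore a s r mu Q :
  Q r (Memory (wmem mu) (upd (rmem mu) (wreg r a) (rreg r s)))
    (op_trace [::] [:: inr (wreg r a)]) ->
  wp (RStore a s) r mu Q.
Proof. by move=> HQ; do 3 eexists; split; [constructor | exact: HQ]. Qed.

Lemma wp_Seq c1 c2 r mu Q :
  wp c1 r mu (fun r1 mu1 t1 =>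
    wp c2 r1 mu1 (fun r2 mu2 t2 => Q r2 mu2 (seq_trace t1 t2))) ->
  wp (Seq c1 c2) r mu Q.
Proof.
move=> [r1 [mu1 [t1 [H1 [r2 [mu2 [t2 [H2 HQ]]]]]]]].
by do 3 eexists; split; [econstructor; eassumption | exact: HQ].
Qed.

Lemma wp_IfW a b c1 c2 r mu Q :
  wp (if wreg r a <= wreg r b then c1 else c2) r mu
     (fun r' mu' t => Q r' mu' (seq_trace (op_trace [::] [::]) t)) ->
  wp (IfW a b c1 c2) r mu Q.
Proof.
move=> [r' [mu' [t [H HQ]]]].
by do 3 eexists; split; [econstructor; eassumption | exact: HQ].
Qed.

Lemma wp_IfR a b c1 c2 r mu Q :
  wp (if (rreg r a <= rreg r b)%R then c1 else c2) r mu
     (fun r' mu' t => Q r' mu' (seq_trace (op_trace [::] [::]) t)) ->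
  wp (IfR a b c1 c2) r mu Q.
Proof.
move=> [r' [mu' [t [H HQ]]]].
by do 3 eexists; split; [econstructor; eassumption | exact: HQ].
Qed.

Lemma wp_Call p r mu Q :
  wp (nth Skip P p) r mu
     (fun _ mu' t => Q r mu' (seq_trace (op_trace [::] [::]) t)) ->
  wp (Call p) r mu Q.
Proof.
move=> [r' [mu' [t [H HQ]]]].
by do 3 eexists; split; [econstructor; eassumption | exact: HQ].
Qed.

(** At a fork, a cell written by neither child is taken from the second child, which left it as it
    was. *)
Lemma run_frame c r mu r' mu' t : run P W c r mu r' mu' t ->
  (forall a, inl a \notin writes t -> wmem mu' a = wmem mu a) /\
  (forall a, inr a \notin writes t -> rmem mu' a = rmem mu a).
Proof.
elim=> {c r mu r' mu' t} //=.
- move=> a s r mu; split=> // b; rewrite inE /upd => nb.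
  by case: (b =P wreg r a) nb => // ->; rewrite eqxx.
- move=> a s r mu; split=> // b; rewrite inE /upd => nb.
  by case: (b =P wreg r a) nb => // ->; rewrite eqxx.
- move=> c1 c2 r mu r1 mu1 t1 r2 mu2 t2 _ [w1 r1E] _ [w2 r2E].
  by split=> a; rewrite mem_cat negb_or => /andP[n1 n2];
     rewrite ?w2 ?w1 ?r2E ?r1E.
- move=> c1 c2 r mu r1 mu1 t1 r2 mu2 t2 _ [w1 r1E] _ [w2 r2E] _.
  by split=> a; rewrite mem_cat negb_or => /andP[n1 n2];
     rewrite (negPf n1) ?w2 ?r2E.
Qed.

Definition merged t1 t2 mu1 mu2 mu' : Prop :=
  [/\ forall a, inl a \notin writes t1 -> wmem mu' a = wmem mu2 a,
      forall a, inr a \notin writes t1 -> rmem mu' a = rmem mu2 a,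
      forall a, inl a \notin writes t2 -> wmem mu' a = wmem mu1 a
    & forall a, inr a \notin writes t2 -> rmem mu' a = rmem mu1 a].

(* Keeping of the merged memory only what [merged] says restores the symmetry
   between the two children. *)
Lemma wp_fork o1 d1 a1 b1 p1 o2 d2 a2 b2 p2 r mu
    (Q1 Q2 : memory R -> trace -> Prop) Q :
  let x1 := word_eval o1 (wreg r a1) (wreg r b1) in
  let x2 := word_eval o2 (wreg r a2) (wreg r b2) in
  x1 < W -> x2 < W ->
  wp (nth Skip P p1) (Regs (upd (wreg r) d1 x1) (rreg r)) mu (fun _ => Q1) ->
  wp (nth Skip P p2) (Regs (upd (wreg r) d2 x2) (rreg r)) mu (fun _ => Q2) ->
  (forall mu1 t1 mu2 t2, Q1 mu1 t1 -> Q2 mu2 t2 -> race_free t1 t2) ->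
  (forall mu1 t1 mu2 t2 mu', Q1 mu1 t1 -> Q2 mu2 t2 ->
     merged t1 t2 mu1 mu2 mu' ->
     Q r mu' (Trace (work t1 + work t2 + 5) (maxn (depth t1) (depth t2) + 3)
                    (reads t1 ++ reads t2) (writes t1 ++ writes t2))) ->
  wp (Par (Seq (WOp o1 d1 a1 b1) (Call p1)) (Seq (WOp o2 d2 a2 b2) (Call p2)))
     r mu Q.
Proof.
move=> x1 x2 lt1 lt2 [r1 [mu1 [t1 [H1 q1]]]] [r2 [mu2 [t2 [H2 q2]]]] rf H.
have C1 := run_Seq (@run_WOp _ P W o1 d1 a1 b1 r mu lt1) (run_Call H1).
have C2 := run_Seq (@run_WOp _ P W o2 d2 a2 b2 r mu lt2) (run_Call H2).
do 3 eexists; split; first by apply: run_Par C1 C2 _; apply: rf q1 q2.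
set mu' := Defs.merge _ _ _; set t' := seq_trace _ _.
(* Each branch pays one operation for its word and one for its call, and the fork itself costs one:
   5 in work, 3 in depth. *)
have -> : t' = Trace (work t1 + work t2 + 5) (maxn (depth t1) (depth t2) + 3)
                     (reads t1 ++ reads t2) (writes t1 ++ writes t2).
  by rewrite /t' /seq_trace /par_trace /=; congr Trace; lia.
apply: H q1 q2 _.
have [[w1 r1E] [w2 r2E]] := (run_frame H1, run_frame H2).
split=> a /= na; rewrite ?(negPf na) //; case: ifPn => // n1.
  by rewrite w1 // w2.
by rewrite r1E // r2E.
Qed.

Lemma wp_frame c r mu Q :
  wp c r mu (fun r' mu' t =>
    (forall a, inl a \notin writes t -> wmem mu' a = wmem mu a) ->
    (forall a, inr a \notin writes t -> rmem mu' a = rmem mu a) ->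
    Q r' mu' t) ->
  wp c r mu Q.
Proof.
move=> [r' [mu' [t [H HQ]]]]; have [? ?] := run_frame H.
by exists r', mu', t; split=> //; apply: HQ.
Qed.

End WeakestPrecondition.

(** * The program *)

Definition block (cs : seq cmd) (c : cmd) : cmd := foldr Seq c cs.

(** Adding the zero held in register 5 serves as a move instruction. *)
Definition copy d s := WOp WAdd d s 5.

(* Word registers: 0 holds the number m of goods, 1 and 2 the bounds lo and hi
   of the current interval, 3 its midpoint, 4 an address; 5, 6, 7 hold the
   constants 0, 1, 2 and 8 holds 2m. *)

Definition midpoint : cmd := Seq (WOp WAdd 3 1 2) (WOp WDiv 3 3 7).

(* In-place sums: when it ends on [lo, hi), cell 2m + hi - 1 contains the sum
   of the interval, and the sums of the left halves met in the recursion are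
   still in place. *)
Definition sweep : cmd :=
  Seq (WOp WAdd 3 1 6)
 (IfW 2 3
   (block [:: RLoad 1 1; WOp WAdd 4 8 1] (RStore 4 1))
   (block [:: midpoint;
              Par (Seq (copy 2 3) (Call 1)) (Seq (copy 1 3) (Call 1));
              WOp WAdd 4 8 3; WOp WSub 4 4 6; RLoad 1 4;
              WOp WAdd 4 8 2; WOp WSub 4 4 6; RLoad 2 4;
              ROp RAdd 1 1 2]
          (RStore 4 1))).

(** Taking the midpoint out before the fork makes the empty interval the base case; the half of
    agent 1 may indeed be empty. *)
Definition fill : cmd :=
  IfW 2 1 Skip
   (block [:: midpoint; WStore 3 6]
          (Par (Seq (copy 2 3) (Call 3)) (Seq (WOp WAdd 1 3 6) (Call 3)))).

(* Real registers: 1 and 2 hold the values of all goods for agents 0 and 1,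
   3 and 4 the values of the goods before lo. *)
Definition descend : cmd :=
  Seq (WOp WAdd 3 1 6)
 (IfW 2 3
   (block [:: WOp WAdd 4 0 1; RLoad 5 4; ROp RAdd 5 4 5; ROp RSub 5 2 5]
     (IfR 4 5
       (block [:: WOp WAdd 1 1 6; copy 2 0] (Call 3))
       (block [:: copy 2 1; copy 1 5] (Call 3))))
   (block [:: midpoint;
              WOp WAdd 4 8 3; WOp WSub 4 4 6; RLoad 5 4;
              WOp WAdd 4 4 0; RLoad 6 4;
              ROp RAdd 5 3 5; ROp RAdd 6 4 6; ROp RAdd 7 5 5]
     (IfR 1 7
       (Seq (copy 2 3) (Call 2))
       (block [:: copy 1 3; ROp RAdd 3 5 0; ROp RAdd 4 6 0] (Call 2))))).

Definition cut_and_choose : cmd :=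
  IfW 0 5 Skip
   (block [:: WConst 6 1; WConst 7 2; WOp WAdd 8 0 0;
              copy 2 0; Call 1;
              copy 1 0; copy 2 8; Call 1;
              WOp WAdd 4 8 0; WOp WSub 4 4 6; RLoad 1 4;
              WOp WAdd 4 4 0; RLoad 2 4;
              copy 1 5; copy 2 0]
          (Call 2)).

Definition ef1_program : program := [:: cut_and_choose; sweep; descend; fill].

(** Symbolic execution of one command. Forks go through [wp_fork], since the postconditions of both
    children must be chosen. *)
Ltac wp_step :=
  first [ apply: wp_Seq | apply: wp_WOp | apply: wp_WConst | apply: wp_WStore
        | apply: wp_ROp | apply: wp_RLoad | apply: wp_RStore | apply: wp_Skip
        | apply: wp_IfW | apply: wp_IfR | apply: wp_Call ];
  rewrite /upd /=.

(** * Correctness and cost of the procedures, beginning with the marking of goods *)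

Section Correctness.
Variables (R : realType) (m W : nat).
(** For positive [m] no computed word exceeds [4m], the value of [2m + hi] at the root of agent 1's
    sweep. *)
Hypothesis leW : 4 * m + 4 <= W.
Implicit Types (r : regs R) (mu : memory R) (t : trace).

Local Notation wp := (wp ef1_program W).

Definition good_regs r lo hi : Prop :=
  [/\ [/\ wreg r 0 = m, wreg r 1 = lo & wreg r 2 = hi]
    & [/\ wreg r 5 = 0, wreg r 6 = 1, wreg r 7 = 2 & wreg r 8 = m + m]].

Definition word_in lo hi (l : loc) : bool :=
  if l is inl a then lo <= a < hi else false.

(** Removing [s] midpoints recursively leaves [s + 1] empty intervals, hence [2s + 1] calls, each of
    constant cost. *)
Definition fill_spec lo hi h mu (mu' : memory R) (t : trace) : Prop :=
  [/\ reads t = [::], all (word_in lo hi) (writes t),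
      (forall a, wmem mu' a = if lo <= a < hi then 1 else wmem mu a),
      work t <= 10 * (2 * (hi - lo) + 1) & depth t <= 10 * h + 10].

(** Reduces race freedom to arithmetic on address ranges. *)
Lemma all_disjoint (T : eqType) (p q : pred T) (s1 s2 : seq T) :
  all p s1 -> all q s2 -> (forall x, p x -> ~~ q x) -> ~~ has (mem s1) s2.
Proof.
move=> /allP ps /allP qs pq; apply/hasPn => x /qs qx; apply/negP => /ps px.
by move: (pq _ px); rewrite qx.
Qed.

Lemma all_notin (T : eqType) (p : pred T) (s : seq T) x :
  all p s -> ~~ p x -> x \notin s.
Proof. by move=> /allP ps; apply: contra => /ps. Qed.

Lemma fill_correct h lo hi r mu :
  hi - lo < 2 ^ h -> lo <= hi -> hi <= m -> good_regs r lo hi ->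
  wp fill r mu (fun _ => fill_spec lo hi h mu).
Proof.
elim: h lo hi r mu => [|h IH] lo hi [w rr] mu lt_h le_lh le_hm
  [[/= w0 w1 w2] [/= w5 w6 w7 w8]].
  have hl : hi <= lo by lia.
  wp_step; rewrite w1 w2 hl; wp_step.
  split=> //= [a|]; last lia.
  by case: ifP => //; lia.
rewrite expnS in lt_h.
wp_step; rewrite w1 w2; case: ifP => hl.
  wp_step; split=> //= [a||]; [|lia|lia].
  by case: ifP => //; lia.
do 3! wp_step; first by rewrite w1 w2; lia.
wp_step; first by rewrite w1 w2 w7; lia.
rewrite w1 w2 w7; set mid := _ %/ 2.
have mid_lh : lo <= mid < hi by rewrite /mid; lia.
do 2! wp_step; rewrite w6.
apply: (wp_fork (Q1 := fill_spec lo mid h _) (Q2 := fill_spec mid.+1 hi h _)).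
- by rewrite /= w5; lia.
- by rewrite /= w6; lia.
- by apply: IH; try lia; split; split; rewrite /upd //=; lia.
- by apply: IH; try lia; split; split; rewrite /upd //=; lia.
- move=> mu1 t1 mu2 t2 [R1 W1 _ _ _] [R2 W2 _ _ _].
  (* Nothing is read, and [mid] separates the two ranges of writes. *)
  rewrite /race_free R1 R2 /= andbT.
  by apply: all_disjoint W1 W2 _ => -[] //= a; lia.
move=> mu1 t1 mu2 t2 mu' [R1 W1 E1 k1 d1] [R2 W2 E2 k2 d2] [M1 _ M2 _].
split=> /=.
- by rewrite R1 R2.
- rewrite all_cat; apply/and3P; split; first by rewrite mid_lh.
    by apply: sub_all W1 => -[] //= a; lia.
  by apply: sub_all W2 => -[] //= a; lia.
- move=> a; case: (leqP a mid) => am.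
    rewrite M2; last by apply: all_notin W2 _ => /=; lia.
    rewrite E1 /upd /=; case: eqP => [->|nm]; last first.
      by congr (if _ then _ else _); lia.
    by rewrite mid_lh ltnn andbF.
  rewrite M1; last by apply: all_notin W1 _ => /=; lia.
  by rewrite E2 /upd /= gtn_eqF //; congr (if _ then _ else _); lia.
- lia.
- lia.
Qed.

(** * Interval sums and the up-sweep *)

Section Sums.
Local Open Scope ring_scope.
Variable f : nat -> R.

Definition interval_sum lo hi : R := \sum_(lo <= x < hi) f x.

Lemma interval_sum1 a : interval_sum a a.+1 = f a.
Proof. exact: big_nat1. Qed.

Lemma interval_sum_cat lo mid hi : (lo <= mid <= hi)%N ->
  interval_sum lo hi = interval_sum lo mid + interval_sum mid hi.
Proof. by move=> /andP[? ?]; apply: big_cat_nat. Qed.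

(* The sums of all left halves met by halving [lo, hi) down to singletons are
   present, each next to the end of its half. *)
Inductive swept (T : nat -> R) : nat -> nat -> Prop :=
| swept_leaf lo : swept T lo lo.+1
| swept_node lo hi of (lo.+1 < hi)%N
    & T (m + m + (lo + hi) %/ 2 - 1)%N = interval_sum lo ((lo + hi) %/ 2)
    & swept T lo ((lo + hi) %/ 2) & swept T ((lo + hi) %/ 2) hi :
    swept T lo hi.

Lemma swept_split T lo hi : (lo.+1 < hi)%N -> swept T lo hi ->
  [/\ T (m + m + (lo + hi) %/ 2 - 1)%N = interval_sum lo ((lo + hi) %/ 2),
      swept T lo ((lo + hi) %/ 2) & swept T ((lo + hi) %/ 2) hi].
Proof. by move=> lt sw; case: sw lt => // lo'; rewrite ltnn. Qed.

Lemma swept_ltn T lo hi : swept T lo hi -> (lo < hi)%N.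
Proof. by elim=> // *; lia. Qed.

End Sums.

(** Left halves end strictly before [hi], so the cell [2m + hi - 1] is left free: the parent call
    may overwrite it with its own total. *)
Lemma swept_local f f' T T' lo hi : swept f T lo hi ->
  (forall a, lo <= a < hi -> f' a = f a) ->
  (forall a, m + m + lo <= a -> a.+1 < m + m + hi -> T' a = T a) ->
  swept f' T' lo hi.
Proof.
elim=> {lo hi} [lo|lo hi lt E sw1 IH1 sw2 IH2] f'E T'E; first by constructor.
have l1 := swept_ltn sw1; have l2 := swept_ltn sw2.
constructor=> //.
- rewrite T'E ?E; try lia.
  by apply: eq_big_nat => a ?; rewrite f'E //; lia.
- by apply: IH1 => a *; [apply: f'E | apply: T'E]; lia.
- by apply: IH2 => a *; [apply: f'E | apply: T'E]; lia.
Qed.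

Definition real_in lo hi (l : loc) : bool :=
  if l is inr a then lo <= a < hi else false.

(** The factor [2 * (hi - lo) - 1] counts the nodes of a binary tree with [hi - lo] leaves. *)
Definition sweep_spec lo hi h mu (mu' : memory R) (t : trace) : Prop :=
  [/\ [/\ all (fun l => real_in lo hi l || real_in (m + m + lo) (m + m + hi) l)
              (reads t),
          all (real_in (m + m + lo) (m + m + hi)) (writes t),
          work t <= 20 * (2 * (hi - lo) - 1) & depth t <= 20 * h + 20],
      swept (rmem mu) (rmem mu') lo hi
    & rmem mu' (m + m + hi - 1) = interval_sum (rmem mu) lo hi].

(** Here [h] is arbitrary because uneven halving reaches leaves at different heights. *)
Lemma sweep_leaf h lo r mu :
  lo < m + m -> good_regs r lo lo.+1 ->
  wp sweep r mu (fun _ => sweep_spec lo lo.+1 h mu).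
Proof.
case: r => w rr lt_lo [[/= w0 w1 w2] [/= w5 w6 w7 w8]].
do 2 wp_step; first by rewrite w1 w6; lia.
wp_step; rewrite w1 w2 w6 ifT; last lia.
do 4 wp_step; first by rewrite w1 w8; lia.
wp_step; rewrite w1 w8; split=> /=.
- by split=> //=; lia.
- exact: swept_leaf.
- by rewrite ifT ?interval_sum1 //; lia.
Qed.

(** Inputs lie below [2m] and sums from [2m] on; both regions are split at [mid], so the children do
    not race. The final store replaces only the total of the right half, and that of the left half
    survives. *)
Lemma sweep_correct h lo hi r mu :
  hi - lo <= 2 ^ h -> lo < hi -> hi <= m + m -> good_regs r lo hi ->
  wp sweep r mu (fun _ => sweep_spec lo hi h mu).
Proof.
elim: h lo hi r mu => [|h IH] lo hi r mu le_h lt_lh le_hm gr.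
  have hiE : hi = lo.+1 by lia.
  by rewrite hiE in gr *; apply: sweep_leaf => //; lia.
case: (leqP hi lo.+1) => hl.
  have hiE : hi = lo.+1 by lia.
  by rewrite hiE in gr *; apply: sweep_leaf => //; lia.
case: r gr => w rr [[/= w0 w1 w2] [/= w5 w6 w7 w8]].
do 2 wp_step; first by rewrite w1 w6; lia.
wp_step; rewrite w1 w2 w6 ifF; last lia.
rewrite expnS in le_h.
do 3! wp_step; first by rewrite w1 w2; lia.
wp_step; first by rewrite w1 w2 w7; lia.
rewrite w1 w2 w7; set mid := _ %/ 2.
have mid_lh : lo < mid < hi by rewrite /mid; lia.
wp_step.
apply: (wp_fork (Q1 := sweep_spec lo mid h _) (Q2 := sweep_spec mid hi h _)).
- by rewrite /= w5; lia.
- by rewrite /= w5; lia.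
- by apply: IH; try lia; split; split; rewrite /upd //=; lia.
- by apply: IH; try lia; split; split; rewrite /upd //=; lia.
- move=> mu1 t1 mu2 t2 [[R1 W1 _ _] _ _] [[R2 W2 _ _] _ _].
  rewrite /race_free has_cat negb_or -andbA; apply/and3P; split.
  + by apply: all_disjoint W1 R2 _ => -[] //= a; lia.
  + by apply: all_disjoint W1 W2 _ => -[] //= a; lia.
  + by apply: all_disjoint W2 R1 _ => -[] //= a; lia.
move=> mu1 t1 mu2 t2 mu' [[R1 W1 k1 d1] sw1 E1] [[R2 W2 k2 d2] sw2 E2].
move=> [_ M1 _ M2].
do 2 wp_step; first by rewrite w8; lia.
do 2 wp_step; first by rewrite w8 w6; lia.
do 4 wp_step; first by rewrite w8 w2; lia.
do 2 wp_step; first by rewrite w8 w6 w2; lia.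
do 5 wp_step; rewrite w8 w6 w2.
have low a : a < m + m + mid -> rmem mu' a = rmem mu1 a.
  by move=> ?; apply: M2; apply: all_notin W2 _ => /=; lia.
have high a : m + m + mid <= a -> rmem mu' a = rmem mu2 a.
  by move=> ?; apply: M1; apply: all_notin W1 _ => /=; lia.
split=> /=; [split=> /= | |].
- rewrite !all_cat /= -!andbA; apply/and5P; split=> //; try lia.
    by apply: sub_all R1 => -[] //= a; lia.
  by apply: sub_all R2 => -[] //= a; lia.
- rewrite !all_cat /= -!andbA; apply/and3P; split; try lia.
    by apply: sub_all W1 => -[] //= a; lia.
  by apply: sub_all W2 => -[] //= a; lia.
- by lia.
- by lia.
- apply: swept_node; rewrite -/mid; first lia.
  + by rewrite ltn_eqF ?low ?E1 //; lia.
  + by apply: swept_local sw1 _ _ => // a ? ?; rewrite ltn_eqF ?low //; lia.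
  + by apply: swept_local sw2 _ _ => // a ? ?; rewrite ltn_eqF ?high //; lia.
- by rewrite eqxx low ?high ?E1 ?E2 -?interval_sum_cat //; lia.
Qed.

(** * Binary search for the cut *)

Section Descent.
Local Open Scope ring_scope.
Variable f : nat -> R.

(* [l] splits the goods, ordered by index, into two halves that agent 0 finds
   acceptable wherever [l] goes with the half she is left with; agent 1, whose
   goods are marked by 1, takes the half she prefers without [l]. *)
Definition cut_spec l (o : nat -> nat) : Prop :=
  [/\ (l < m)%N,
      interval_sum f 0 l <= interval_sum f l m,
      interval_sum f l.+1 m <= interval_sum f 0 l.+1
    & if interval_sum f m (m + l) <= interval_sum f (m + l.+1) (m + m)
      then forall a, o a = (l < a < m)%N :> nat
      else forall a, o a = (a < l)%N :> nat].

(** Real register 0 stays zero so that adding it copies a real. *)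
Definition descend_regs r lo hi : Prop :=
  [/\ good_regs r lo hi, rreg r 0 = 0,
      rreg r 1 = interval_sum f 0 m /\ rreg r 2 = interval_sum f m (m + m),
      rreg r 3 = interval_sum f 0 lo & rreg r 4 = interval_sum f m (m + lo)].

(** [h] bounds the height of the remaining descent, [h0] that of the final [fill], which accounts
    for the work linear in [m]. *)
Definition descend_spec h h0 (mu' : memory R) (t : trace) : Prop :=
  [/\ exists l, cut_spec l (wmem mu'),
      (work t <= 20 * h + 20 * m + 40)%N
    & (depth t <= 20 * h + 10 * h0 + 40)%N].

(** On a single good the two invariants of the search are agent 0's conditions on [l = lo]; only
    agent 1's choice remains. *)
Lemma descend_leaf h h0 lo r mu :
  (m < 2 ^ h0)%N -> (lo < m)%N -> descend_regs r lo lo.+1 ->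
  (forall a, (a < m + m)%N -> rmem mu a = f a) ->
  (forall a, wmem mu a = 0%N) ->
  interval_sum f 0 lo <= interval_sum f lo m ->
  interval_sum f lo.+1 m <= interval_sum f 0 lo.+1 ->
  wp descend r mu (fun _ => descend_spec h h0).
Proof.
case: r => w rr lt_m lt_lo.
move=> [[[/= w0 w1 w2] [/= w5 w6 w7 w8]] r0 [/= r1 r2] r3 r4] mf mw cl ch.
do 2 wp_step; first by rewrite w1 w6; lia.
wp_step; rewrite w1 w2 w6 ifT; last lia.
do 2 wp_step; first by rewrite w1 w0; lia.
do 7 wp_step; rewrite w1 w0 r4 r2 mf; last lia.
(* The subtraction yields agent 1's value of the goods after [lo], so the test compares the two
   halves without [lo]. *)
have -> : interval_sum f m (m + m) - (interval_sum f m (m + lo) + f (m + lo)%N)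
          = interval_sum f (m + lo.+1) (m + m).
  rewrite (interval_sum_cat f (mid := (m + lo)%N)); last lia.
  rewrite (interval_sum_cat f (lo := (m + lo)%N) (mid := (m + lo.+1)%N));
    last lia.
  rewrite addnS interval_sum1; ring.
case: ifP => choice.
  do 2 wp_step; first by rewrite w1 w6; lia.
  do 2 wp_step; first by rewrite w0 w5; lia.
  wp_step; apply: wp_mono.
    apply: (fill_correct (h := h0) (lo := lo.+1) (hi := m)); try lia.
    by split; split; rewrite /upd //=; lia.
  move=> _ mu' t [_ _ E k d]; split=> /=; [|lia|lia].
  exists lo; split=> //; rewrite choice => a; rewrite E mw.
  by case: ifP.
do 2 wp_step; first by rewrite w1 w5; lia.
do 2 wp_step; first by rewrite w5; lia.
wp_step; apply: wp_mono.
  apply: (fill_correct (h := h0) (lo := 0) (hi := lo)); try lia.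
  by split; split; rewrite /upd //=; lia.
move=> _ mu' t [_ _ E k d]; split=> /=; [|lia|lia].
exists lo; split=> //; rewrite choice => a; rewrite E mw.
by rewrite leq0n; case: (a < lo)%N.
Qed.

(** For agent 0, the left part is at most the right part at [lo], and conversely at [hi]. One of the
    two holds at the midpoint, which replaces the corresponding bound. *)
Lemma descend_correct h h0 lo hi r mu :
  (m < 2 ^ h0)%N -> (hi - lo <= 2 ^ h)%N -> (lo < hi <= m)%N ->
  descend_regs r lo hi ->
  (forall a, (a < m + m)%N -> rmem mu a = f a) ->
  (forall a, wmem mu a = 0%N) ->
  swept f (rmem mu) lo hi -> swept f (rmem mu) (m + lo) (m + hi) ->
  interval_sum f 0 lo <= interval_sum f lo m ->
  interval_sum f hi m <= interval_sum f 0 hi ->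
  wp descend r mu (fun _ => descend_spec h h0).
Proof.
move=> lt_m; elim: h lo hi r mu => [|h IH] lo hi r mu le_h lt_lh gr mf mw
  sw1 sw2 cl ch.
  have hiE : hi = lo.+1 by lia.
  by rewrite hiE in gr ch *; apply: descend_leaf gr _ _ _ _ => //; lia.
case: (leqP hi lo.+1) => hl.
  have hiE : hi = lo.+1 by lia.
  by rewrite hiE in gr ch *; apply: descend_leaf gr _ _ _ _ => //; lia.
rewrite expnS in le_h.
case: r gr => w rr [[[/= w0 w1 w2] [/= w5 w6 w7 w8]] r0 [/= r1 r2] r3 r4].
do 2 wp_step; first by rewrite w1 w6; lia.
wp_step; rewrite w1 w2 w6 ifF; last lia.
have [E1 sl1 sr1] := swept_split hl sw1.
have hl2 : ((m + lo).+1 < m + hi)%N by lia.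
have [] := swept_split hl2 sw2.
(* Shifting both bounds by [m] shifts the midpoint by exactly [m]: the trees of the two agents have
   the same shape, and one descent follows both. *)
have -> : ((m + lo + (m + hi)) %/ 2 = m + (lo + hi) %/ 2)%N by lia.
move=> E2 sl2 sr2.
do 3 wp_step; first by rewrite w1 w2; lia.
wp_step; first by rewrite w1 w2 w7; lia.
rewrite w1 w2 w7; set mid := (_ %/ 2)%N in E1 sl1 sr1 E2 sl2 sr2 *.
have mid_lh : (lo < mid < hi)%N by rewrite /mid; lia.
do 2 wp_step; first by rewrite w8; lia.
do 2 wp_step; first by rewrite w8 w6; lia.
do 4 wp_step; first by rewrite w8 w6 w0; lia.
do 9 wp_step; rewrite w8 w6 w0 r3 r4 r1 E1.
have -> : (m + m + mid - 1 + m = m + m + (m + mid) - 1)%N by lia.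
rewrite E2 -!interval_sum_cat; [|lia|lia].
(* Cancelling the left sum turns the test of the total against twice the left sum into a comparison
   of right with left. *)
rewrite (interval_sum_cat f (lo := 0) (mid := mid) (hi := m)); last lia.
rewrite lerD2l; case: ifP => choice.
  do 2 wp_step; first by rewrite w5; lia.
  wp_step; apply: wp_mono; first apply: (IH lo mid) => //; try lia.
    by split; rewrite /upd //=; split; split=> //=; lia.
  by move=> _ mu' t [H k d]; split=> //=; lia.
do 2 wp_step; first by rewrite w5; lia.
do 5 wp_step; apply: wp_mono; first apply: (IH mid hi) => //; try lia.
- by split; rewrite /upd //= ?r0 ?addr0 //; split; split=> //=; lia.
- by apply: ltW; rewrite ltNge choice.
by move=> _ mu' t [H k d]; split=> //=; lia.
Qed.
End Descent.

Lemma cut_and_choose_correct r mu :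
  0 < m -> wreg r 0 = m -> (forall x, x != 0 -> wreg r x = 0) ->
  (forall x, rreg r x = 0%R) -> (forall a, wmem mu a = 0) ->
  (forall a, a < m + m -> (0 <= rmem mu a)%R) ->
  wp cut_and_choose r mu (fun _ mu' t =>
    [/\ exists l, cut_spec (rmem mu) l (wmem mu'),
        work t <= 300 * m & depth t <= 100 * trunc_log 2 m + 250]).
Proof.
case: r => w rr m0 /= w0 wE rE mw f0.
have [w1 w5] : w 1 = 0 /\ w 5 = 0 by rewrite !wE.
wp_step; rewrite w0 w5 ifF; last lia.
set h := (trunc_log 2 m).+1.
have lt_m : m < 2 ^ h by rewrite trunc_log_ltn.
(* The work of the descent is proportional to [h]; this absorbs it into the linear bound. *)
have le_log : trunc_log 2 m <= m.
  apply: leq_trans (trunc_logP (isT : 1 < 2) m0).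
  exact: ltnW (ltn_expl _ _).
do 2 wp_step; first lia.
do 2 wp_step; first lia.
do 2 wp_step; first by rewrite w0; lia.
do 2 wp_step; first by rewrite w0 w5; lia.
do 2 wp_step; apply: wp_frame; apply: wp_mono.
  apply: (sweep_correct (h := h) (lo := 0) (hi := m)); try lia.
  by split; split; rewrite /upd //=; lia.
move=> _ mu1 t1 [[_ W1 k1 d1] sw1 E1] fw1 fr1.
do 2 wp_step; first by rewrite w0 w5; lia.
do 2 wp_step; first by rewrite w0 w5; lia.
do 2 wp_step; apply: wp_frame; apply: wp_mono.
  apply: (sweep_correct (h := h) (lo := m) (hi := m + m)); try lia.
  by split; split; rewrite /upd //=; lia.
move=> _ mu2 t2 [[_ W2 k2 d2] sw2 E2] fw2 fr2.
do 2 wp_step; first by rewrite w0; lia.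
do 2 wp_step; first by rewrite w0; lia.
do 4 wp_step; first by rewrite w0; lia.
do 4 wp_step; first by rewrite w5; lia.
do 2 wp_step; first by rewrite w0 w5; lia.
(* The first sweep writes only in [[2m, 3m)] and the second in [[3m, 4m)]: the inputs and the first
   agent's sums survive. *)
have mu1E a : a < m + m -> rmem mu1 a = rmem mu a.
  by move=> ?; apply: fr1; apply: all_notin W1 _ => /=; lia.
have mu2E a : a < m + m + m -> rmem mu2 a = rmem mu1 a.
  by move=> ?; apply: fr2; apply: all_notin W2 _ => /=; lia.
have mw2 a : wmem mu2 a = 0.
  by rewrite fw2 ?fw1 ?mw //; [apply: all_notin W1 _|apply: all_notin W2 _].
have sumE lo hi : hi <= m + m ->
    interval_sum (rmem mu1) lo hi = interval_sum (rmem mu) lo hi.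
  by move=> ?; apply: eq_big_nat => a ?; apply: mu1E; lia.
(* Gives both search invariants on [[0, m)], where the part outside is empty. *)
have sum_ge0 : (0 <= interval_sum (rmem mu) 0 m)%R.
  by rewrite /interval_sum big_nat; apply: sumr_ge0 => a ?; apply: f0; lia.
have sum0 a : interval_sum (rmem mu) a a = 0%R by rewrite /interval_sum big_geq.
wp_step; apply: wp_mono.
  apply: (descend_correct (f := rmem mu) (h := h) (h0 := h) (lo := 0)
                          (hi := m));
    rewrite ?addn0 ?sum0 //; try lia.
  - split; rewrite /upd //= ?rE ?addn0 ?sum0 //.
      by split; split=> //=; lia.
    rewrite w0; split; first by rewrite mu2E ?E1 //; lia.
    by rewrite -sumE // -E2; congr (rmem mu2); lia.
  - by move=> a ?; rewrite mu2E ?mu1E //; lia.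
  - by apply: swept_local sw1 _ _ => // a ? ?; apply: mu2E; lia.
  - by apply: swept_local sw2 _ _ => // a ?; rewrite mu1E //; lia.
move=> _ mu' t [H k d]; split=> //=; lia.
Qed.
End Correctness.

(** * From the cut to an EF1 allocation *)

Section EnvyFreeness.
Local Open Scope ring_scope.
Variables (R : realType) (n m : nat) (v : 'I_n -> {set 'I_m} -> R).
Hypothesis v_additive : forall i, additive_valuation (v i).

Lemma additive_mono i (S T : {set 'I_m}) : S \subset T -> v i S <= v i T.
Proof.
have [v0 vS] := v_additive i; move=> ST.
rewrite (vS S) (vS T) [leRHS](big_setID S) /= (setIidPr ST) lerDl.
by apply: sumr_ge0 => g _; apply: v0.
Qed.

Lemma envy_free_EF1 (A : allocation n m) i j :
  v i (bundle A j) <= v i (bundle A i) ->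
  bundle A j = set0 \/
  exists2 s, s \in bundle A j & v i (bundle A j :\ s) <= v i (bundle A i).
Proof.
move=> ef; have [->|[s sA]] := set_0Vmem (bundle A j); first by left.
right; exists s => //; apply: le_trans ef.
by apply: additive_mono (subsetDl _ _).
Qed.

(** Passes from sets of goods to ranges of cells, the form in which the cut is specified. *)
Lemma additive_interval (f : nat -> R) (i : 'I_n) (S : {set 'I_m}) lo hi :
  (hi <= m)%N ->
  (forall g : 'I_m, f (i * m + g)%N = v i [set g]) ->
  (forall g : 'I_m, (g \in S) = (lo <= g < hi)%N) ->
  v i S = interval_sum f (i * m + lo) (i * m + hi).
Proof.
move=> hm fE SE; rewrite (v_additive i).2.
rewrite (eq_big (fun g : 'I_m => lo <= g < hi)%N
                (fun g : 'I_m => f (i * m + g)%N)) //.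
rewrite /interval_sum [(i * m + lo)%N]addnC big_addn addKn.
rewrite -(big_mkord (fun g => lo <= g < hi)%N (fun g => f (i * m + g)%N)).
rewrite (big_nat_widen _ _ _ _ _ hm) [RHS](big_nat_widenl _ 0) //.
apply: eq_big => g //=; last by rewrite addnC.
by rewrite andbC.
Qed.

End EnvyFreeness.

Section TwoAgents.
Local Open Scope ring_scope.
Variables (R : realType) (m : nat) (v : 'I_2 -> {set 'I_m} -> R).
Hypothesis v_additive : forall i, additive_valuation (v i).

(** On the marks of a cut, which are 0 or 1, [inord] loses nothing. *)
Definition marked_allocation (o : nat -> nat) : allocation 2 m :=
  [ffun g : 'I_m => inord (o g)].

Lemma EF1_two (A : allocation 2 m) :
  (bundle A 1 = set0 \/ exists2 s, s \in bundle A 1 &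
     v 0 (bundle A 1 :\ s) <= v 0 (bundle A 0)) ->
  (bundle A 0 = set0 \/ exists2 s, s \in bundle A 0 &
     v 1 (bundle A 0 :\ s) <= v 1 (bundle A 1)) ->
  EF1 v A.
Proof.
move=> e01 e10 i j.
have [->|ij] := eqVneq i j; first exact: envy_free_EF1.
have ord2 (k : 'I_2) : k = 0 \/ k = 1.
  by case: k => -[|[|k]] // lt; [left | right]; apply: val_inj.
by case: (ord2 i) (ord2 j) ij => -> [] ->.
Qed.

Lemma cut_EF1 f l o :
  (forall (i : 'I_2) (g : 'I_m), f (i * m + g)%N = v i [set g]) ->
  cut_spec m f l o -> EF1 v (marked_allocation o).
Proof.
move=> fE [lt_l cl ch co].
have memA (i : 'I_2) (g : 'I_m) b : o g = nat_of_bool b ->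
    (g \in bundle (marked_allocation o) i) = (i == b :> nat).
  move=> og; rewrite inE ffunE og -val_eqE /= inordK; last by case: b {og}.
  by rewrite eq_sym.
have vE0 (S : {set 'I_m}) lo hi : (hi <= m)%N ->
    (forall g : 'I_m, (g \in S) = (lo <= g < hi)%N) ->
    v 0 S = interval_sum f lo hi.
  by move=> hm SE; rewrite (additive_interval v_additive hm (fE 0) SE) !mul0n.
have vE1 (S : {set 'I_m}) lo hi : (hi <= m)%N ->
    (forall g : 'I_m, (g \in S) = (lo <= g < hi)%N) ->
    v 1 S = interval_sum f (m + lo) (m + hi).
  by move=> hm SE; rewrite (additive_interval v_additive hm (fE 1) SE) !mul1n.
have mem_l (S : {set 'I_m}) (g : 'I_m) :
  (g \in S :\ Ordinal lt_l) = (g != l :> nat) && (g \in S) by rewrite !inE.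
case: ifP co => choice co; apply: EF1_two.
(* Agent 1 holds [(l, m)]: [ch] satisfies agent 0, who holds [[0, l]], and [choice] satisfies agent
   1 once [l] is removed. *)
- apply: (envy_free_EF1 v_additive).
  rewrite (vE0 _ l.+1 m) ?(vE0 (bundle _ 0) 0 l.+1) // => g;
    by rewrite (memA _ _ _ (co g)) /=; have := ltn_ord g; lia.
- right; exists (Ordinal lt_l).
    by rewrite (memA _ _ _ (co _)) /=; lia.
  rewrite (vE1 _ 0 l) ?(vE1 (bundle _ 1) l.+1 m) ?addn0 //; try lia.
    by move=> g; rewrite (memA _ _ _ (co g)) /=; have := ltn_ord g; lia.
  by move=> g; rewrite mem_l (memA _ _ _ (co g)) /=; have := ltn_ord g; lia.
(* Agent 1 holds [[0, l)]: now [cl] satisfies agent 0, and the negated [choice] agent 1. *)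
- apply: (envy_free_EF1 v_additive).
  rewrite (vE0 _ 0 l) ?(vE0 (bundle _ 0) l m) //; try lia; move=> g;
    by rewrite (memA _ _ _ (co g)) /=; have := ltn_ord g; lia.
- right; exists (Ordinal lt_l).
    by rewrite (memA _ _ _ (co _)) /=; lia.
  rewrite (vE1 _ l.+1 m) ?(vE1 (bundle _ 1) 0 l) ?addn0 //; try lia.
  + by apply: ltW; rewrite ltNge choice.
  + by move=> g; rewrite (memA _ _ _ (co g)) /=; have := ltn_ord g; lia.
  by move=> g; rewrite mem_l (memA _ _ _ (co g)) /=; have := ltn_ord g; lia.
Qed.

End TwoAgents.

Theorem theorem1 (R : realType) :
  exists (P : program) (c k : nat),
  forall (m : nat) (v : 'I_2 -> {set 'I_m} -> R) (mu : memory R),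
  (forall i, additive_valuation (v i)) ->
  input_memory v mu ->
  exists (r' : regs R) (mu' : memory R) (t : trace) (A : allocation 2 m),
    [/\ run P (word_bound k m) (Call 0) (input_regs R m) mu r' mu' t,
        output_memory A mu',
        EF1 v A
      & 2 <= m -> work t <= c * m /\ depth t <= c * trunc_log 2 m].
Proof.
(* For [m >= 2] the logarithm is at least 1, so the depth bound [100 * log + 250] is below
   [400 * log]. The exponent 2 suffices since [(m + 2) ^ 2 >= 4 * m + 4]. *)
exists ef1_program, 400, 2 => m v mu v_add [mw mv m0].
have leW : 4 * m + 4 <= word_bound 2 m by rewrite /word_bound; nia.
have [m_eq0|m_gt0] := posnP m.
  rewrite {}m_eq0 in v mu v_add mw mv m0 leW *.
  do 3 eexists; exists [ffun=> 0%R]; split.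
  - by apply: run_Call; apply: run_IfW; apply: run_Skip.
  - by case.
  - by move=> i j; left; apply/setP => -[].
  - by [].
have mu_ge0 a : a < m + m -> (0 <= rmem mu a)%R.
  move=> lt_a; case: (ltnP a m) => am.
    by have := mv 0%R (Ordinal am); rewrite mul0n => ->; case: (v_add 0%R).
  have lt_am : a - m < m by lia.
  have := mv 1%R (Ordinal lt_am); rewrite mul1n /= subnKC // => ->.
  by case: (v_add 1%R).
have [] := cut_and_choose_correct (r := input_regs R m) leW m_gt0 _ _ _ mw mu_ge0.
- by [].
- by move=> x /negPf; rewrite /= /upd => ->.
- by [].
move=> r' [mu' [t [H [[l cut] k d]]]].
do 4 eexists; split;
  [exact: (run_Call (P := ef1_program) (p := 0) H) | | exact: cut_EF1 cut |].
- move=> g; rewrite ffunE; case: cut => _ _ _ cut.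
  have [b ->] : exists b : bool, wmem mu' g = b.
    by case: ifP cut => _ ->; eexists.
  by rewrite inordK //; case: b.
- move=> m2 /=; have : 0 < trunc_log 2 m by rewrite trunc_log_gt0.
  by split; lia.
Qed.
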